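(* Let $\mathcal{H}$ be a complex Hilbert space with $\dim\mathcal{H}\geq 2$, let $n\geq 2$ be a fixed integer, and let $\phi:B(\mathcal{H})\rightarrow B(\mathcal{H})$ be a linear mapping. The following are equivalent: (i) $\phi$ is a Lie $n$-centralizer; (ii) $\phi$ satisfies $\mathbf{(N)}$; (iii) $\phi$ satisfies $\mathbf{(N_l)}$; (iv) $\phi$ satisfies $\mathbf{(N_r)}$; (v) $\phi$ satisfies $\mathbf{(T)}$; (vi) $\phi$ satisfies $\mathbf{(T_l)}$; (vii) $\phi$ satisfies $\mathbf{(T_r)}$; (viii) there exist an element $\lambda\in\mathbb{C}$ and a linear map $\mu:B(\mathcal{H})\rightarrow\mathbb{C}$ such that $\phi(A)=\lambda A+\mu(A)I$ for all $A\in B(\mathcal{H})$ and $\mu(p_n(A_1,A_2,\dots,A_n))=0$ for all $A_1,A_2,\dots,A_n\in B(\mathcal{H})$.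
   Context: $B(\mathcal{H})$ is the algebra of all bounded linear operators on $\mathcal{H}$, and $I$ is its identity operator. All linear maps are over $\mathbb{C}$. For elements of an algebra $\mathcal{U}$, $[a,b]=ab-ba$, and $p_n$ is defined recursively by $p_1(a_1)=a_1$ and $p_n(a_1,\dots,a_n)=[p_{n-1}(a_1,\dots,a_{n-1}),a_n]$ for $n\geq 2$. A linear map $\phi:\mathcal{U}\to\mathcal{U}$ is a Lie $n$-centralizer ($n\geq2$) if $\phi(p_n(a_1,a_2,\dots,a_n))=p_n(\phi(a_1),a_2,\dots,a_n)$ for all $a_1,\dots,a_n\in\mathcal{U}$. For a fixed integer $n\geq 2$ and a linear map $\phi:\mathcal{U}\to\mathcal{U}$, consider the following conditions: - $\mathbf{(T_l)}$: $\phi(p_n(a_1,a_2,\dots,a_n))=p_n(\phi(a_1),a_2,\dots,a_n)$ for all $a_1,\dots,a_n\in\mathcal{U}$ with $a_1a_2=0$. - $\mathbf{(T_r)}$: $\phi(p_n(a_1,a_2,\dots,a_n))=p_n(a_1,\phi(a_2),a_3,\dots,a_n)$ for all $a_1,\dots,a_n\in\mathcal{U}$ with $a_1a_2=0$. - $\mathbf{(T)}$: both $\mathbf{(T_l)}$ and $\mathbf{(T_r)}$ hold. - $\mathbf{(N_l)}$: $\phi(p_n(a_1,a_2,\dots,a_n))=p_n(\phi(a_1),a_2,\dots,a_n)$ for all $a_1,\dots,a_n\in\mathcal{U}$ with $a_1a_2\cdots a_n=0$. - $\mathbf{(N_r)}$: $\phi(p_n(a_1,a_2,\dots,a_n))=p_n(a_1,\phi(a_2),a_3,\dots,a_n)$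 for all $a_1,\dots,a_n\in\mathcal{U}$ with $a_1a_2\cdots a_n=0$. - $\mathbf{(N)}$: both $\mathbf{(N_l)}$ and $\mathbf{(N_r)}$ hold. *)

(* Defs.v *)
From HB Require Import structures.
From mathcomp Require Import all_boot all_order all_algebra.
From mathcomp Require Import sesquilinear complex.
From mathcomp Require Import boolp classical_sets functions reals topology normedtype.

Set Implicit Arguments.
Unset Strict Implicit.
Unset Printing Implicit Defensive.
Import Order.TTheory GRing.Theory Num.Theory.
Import numFieldNormedType.Exports.
Local Open Scope ring_scope.

Section BoundedOperators.
Variables (K : numFieldType) (V : normedModType K).

Definition is_bounded_operator (f : V -> V) : Prop :=
  linear f /\ exists M : K, forall x, `|f x| <= M * `|x|.

Definition bounded_operator_pred : {pred V -> V} :=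
  [pred f | `[< is_bounded_operator f >]].

Record bounded_operator := BoundedOperator {
  bounded_operator_fun :> V -> V;
  _ : bounded_operator_fun \in bounded_operator_pred }.

HB.instance Definition _ := [isSub for bounded_operator_fun].
HB.instance Definition _ := [Choice of bounded_operator by <:].

Lemma bounded_operatorP (f : bounded_operator) : is_bounded_operator f.
Proof. by have /asboolP := valP f. Qed.

Lemma bounded_operator_eq (f g : bounded_operator) : f =1 g -> f = g.
Proof. by move=> fg; apply/val_inj/funext. Qed.

Lemma bounded_operator_submod_closed : submod_closed bounded_operator_pred.
Proof.
split.
  apply/asboolP; split; first by move=> a x y /=; rewrite scaler0 addr0.
  by exists 0 => x; rewrite /= normr0 mul0r.
move=> a f g /asboolP[fl [M fM]] /asboolP[gl [N gN]]; apply/asboolP; split.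
  move=> b x y; rewrite !fctE fl gl !scalerDr !scalerA mulrC.
  by rewrite addrACA.
exists (`|a| * M + N) => x; rewrite !fctE mulrDl.
apply: (le_trans (ler_normD _ _)); rewrite lerD//.
by rewrite normrZ -mulrA ler_wpM2l.
Qed.

HB.instance Definition _ := GRing.isSubmodClosed.Build K (V -> V)
  bounded_operator_pred bounded_operator_submod_closed.
HB.instance Definition _ :=
  [SubChoice_isSubLmodule of bounded_operator by <:].

Fact bounded_operator_id_subproof : idfun \in bounded_operator_pred.
Proof. by apply/asboolP; split=> //; exists 1 => x; rewrite mul1r. Qed.

Definition bounded_operator_id := BoundedOperator bounded_operator_id_subproof.

Fact bounded_operator_comp_subproof (f g : bounded_operator) :
  (f : V -> V) \o g \in bounded_operator_pred.
Proof.
have [fl [M fM]] := bounded_operatorP f; have [gl [N gN]] := bounded_operatorP g.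
apply/asboolP; split; first by move=> a x y; rewrite /= gl fl.
have [x0|nx0] := pselect (exists x : V, x != 0); last first.
  exists 0 => x; have [->|xn0] := eqVneq x 0; last by case: nx0; exists x.
  have g0 : g 0 = 0 by have := gl (-1) 0 0; rewrite scaler0 addr0 scaleN1r addNr.
  have f0 : f 0 = 0 by have := fl (-1) 0 0; rewrite scaler0 addr0 scaleN1r addNr.
  by rewrite /= g0 f0 normr0 mulr0.
have M0 : 0 <= M.
  case: x0 => x; rewrite -normr_gt0 => x0.
  by rewrite -(pmulr_lge0 _ x0) (le_trans _ (fM x)).
exists (M * N) => x /=; apply: (le_trans (fM _)).
by rewrite -mulrA ler_wpM2l.
Qed.

Definition bounded_operator_comp (f g : bounded_operator) : bounded_operator :=
  BoundedOperator (bounded_operator_comp_subproof f g).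

Fact bounded_operator_compA : associative bounded_operator_comp.
Proof. by move=> f g h; apply: bounded_operator_eq. Qed.

Fact bounded_operator_comp1f : left_id bounded_operator_id bounded_operator_comp.
Proof. by move=> f; apply: bounded_operator_eq. Qed.

Fact bounded_operator_compf1 : right_id bounded_operator_id bounded_operator_comp.
Proof. by move=> f; apply: bounded_operator_eq. Qed.

Fact bounded_operator_compDl : left_distributive bounded_operator_comp +%R.
Proof. by move=> f g h; apply: bounded_operator_eq. Qed.

Fact bounded_operator_compDr : right_distributive bounded_operator_comp +%R.
Proof.
move=> f g h; apply: bounded_operator_eq => x; have [fl _] := bounded_operatorP f.
by have := fl 1 (g x) (h x); rewrite !scale1r.
Qed.

(* A possibly trivial ring, since [V] may be trivial; this is also why
   [bounded_operator] is not declared as an [algType], which would require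
   [1 != 0]. *)
HB.instance Definition _ := GRing.Zmodule_isPzRing.Build bounded_operator
  bounded_operator_compA bounded_operator_comp1f bounded_operator_compf1
  bounded_operator_compDl bounded_operator_compDr.

Lemma bounded_operatorDE (f g : bounded_operator) x : (f + g) x = f x + g x.
Proof. by []. Qed.

Lemma bounded_operatorZE a (f : bounded_operator) x : (a *: f) x = a *: f x.
Proof. by []. Qed.

Lemma bounded_operator1E x : (1 : bounded_operator) x = x.
Proof. by []. Qed.

Lemma bounded_operatorME (f g : bounded_operator) x : (f * g) x = f (g x).
Proof. by []. Qed.

Lemma bounded_operator_scalerAl a (f g : bounded_operator) :
  a *: (f * g) = (a *: f) * g.
Proof. exact: bounded_operator_eq. Qed.

Lemma bounded_operator_scalerAr a (f g : bounded_operator) :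
  a *: (f * g) = f * (a *: g).
Proof.
apply: bounded_operator_eq => x; have [fl _] := bounded_operatorP f.
have f0 : f 0 = 0 by have := fl (-1) 0 0; rewrite scaler0 addr0 scaleN1r addNr.
by have := fl a (g x) 0; rewrite f0 !addr0.
Qed.

End BoundedOperators.

(* [dim V >= k] as a vector space, [V] being possibly infinite-dimensional. *)
Definition dim_ge (K : fieldType) (V : lmodType K) (k : nat) : Prop :=
  exists v : 'I_k -> V, forall c : 'I_k -> K,
    \sum_(i < k) c i *: v i = 0 -> forall i, c i = 0.

Section LieCentralizers.
Variable U : pzRingType.

Definition lie (a b : U) : U := a * b - b * a.

(* [lie_p [:: a_1; ...; a_n]] is p_n(a_1, ..., a_n), for n >= 1. *)
Definition lie_p (s : seq U) : U :=
  if s is a :: s' then foldl lie a s' else 0.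

Lemma lie_p1 a : lie_p [:: a] = a.
Proof. by []. Qed.

Lemma lie_p_rcons a s b : lie_p (rcons (a :: s) b) = lie (lie_p (a :: s)) b.
Proof. by rewrite /= foldl_rcons. Qed.

(* In the conditions below n >= 2, and the arguments a_1, ..., a_n are split
   as a1, a2 and the (n - 2)-tuple s. *)
Variables (n : nat) (phi : U -> U).

Definition lie_centralizer : Prop :=
  forall (a1 a2 : U) (s : (n - 2).-tuple U),
    phi (lie_p [:: a1, a2 & s]) = lie_p [:: phi a1, a2 & s].

Definition cond_Tl : Prop :=
  forall (a1 a2 : U) (s : (n - 2).-tuple U), a1 * a2 = 0 ->
    phi (lie_p [:: a1, a2 & s]) = lie_p [:: phi a1, a2 & s].

Definition cond_Tr : Prop :=
  forall (a1 a2 : U) (s : (n - 2).-tuple U), a1 * a2 = 0 ->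
    phi (lie_p [:: a1, a2 & s]) = lie_p [:: a1, phi a2 & s].

Definition cond_T : Prop := cond_Tl /\ cond_Tr.

Definition cond_Nl : Prop :=
  forall (a1 a2 : U) (s : (n - 2).-tuple U), \prod_(a <- [:: a1, a2 & s]) a = 0 ->
    phi (lie_p [:: a1, a2 & s]) = lie_p [:: phi a1, a2 & s].

Definition cond_Nr : Prop :=
  forall (a1 a2 : U) (s : (n - 2).-tuple U), \prod_(a <- [:: a1, a2 & s]) a = 0 ->
    phi (lie_p [:: a1, a2 & s]) = lie_p [:: a1, phi a2 & s].

Definition cond_N : Prop := cond_Nl /\ cond_Nr.

End LieCentralizers.

(* Main.v *)
Require Import Defs.
From HB Require Import structures.
From mathcomp Require Import all_boot all_order all_algebra.
From mathcomp Require Import sesquilinear complex ring.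
From mathcomp Require Import boolp classical_sets functions reals topology normedtype.

Set Implicit Arguments.
Unset Strict Implicit.
Unset Printing Implicit Defensive.
Import Order.TTheory GRing.Theory Num.Theory.
Import numFieldNormedType.Exports.
Local Open Scope ring_scope.

(** Each condition asks for an identity between two bilinear expressions in the
    first two arguments, either for all arguments or only when a product
    vanishes. A product [a1 ... an] vanishes as soon as [a1 a2] does, so the
    weakest conditions are (T_l) and (T_r), and everything follows from two
    facts.

    First, (T_l) and (T_r) already imply the identity for all arguments. In a
    ring generated by its idempotents, a biadditive map [psi] that vanishes on
    zero products satisfies [psi (x z) y = psi x (z y)]
    ([zero_product_balanced]). For the defect [psi] of (T_l) this gives
    [psi a b = psi (a b) 1], and for that of (T_r) it gives
    [psi a b = psi 1 (a b)]; both are zero because [1] commutes with everything.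
    That B(H) is generated by its idempotents
    ([bounded_operator_idempotent_generated]) is where the dimension and
    completeness of H enter. A Zorn argument yields a maximal partial isometry
    [v] whose initial space is orthogonal to its final space; maximality leaves
    at most one dimension outside of these two spaces. In the resulting
    decomposition of the identity, every diagonal corner factors through
    off-diagonal corners, and elements of off-diagonal corners are differences
    of idempotents. The partial isometry is handled through its graph, a
    subspace of H x H, so that chains have their union as an upper bound; it
    becomes an operator by means of orthogonal projections onto closed
    subspaces, obtained here from completeness ([graph_projection]).

    Second, a Lie n-centralizer [phi] is a scalar multiple of the identity plus a
    map with scalar values ([commuting_map_scalar]). Its two descriptions show
    that [[phi A, B] - [A, phi B]] is annihilated by all iterated commutators
    of length n - 2, hence is scalar ([foldl_lie_eq0_scalar]). Testing this
    on the rank one operators [<-, u> u] shows that [phi] maps them to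
    combinations of themselves and the identity, then that [phi A u - l A u] is
    a multiple of [u] for every [u], with [l] independent of [u] and [A]; an
    operator for which every vector is an eigenvector is scalar. Since
    scalars disappear in commutators, such a map satisfies the Lie
    n-centralizer identity exactly when its scalar part vanishes on the values
    of p_n. *)

(** * Rings generated by their idempotents *)

Definition idempotent_generated (M : pzRingType) :=
  forall Z : M -> Prop,
    (forall x y, Z x -> Z y -> Z (x - y)) ->
    (forall x y, Z x -> Z y -> Z (x * y)) ->
    (forall e, e * e = e -> Z e) ->
  forall x, Z x.

(** An off-diagonal corner [e_i x e_j] is a difference of two idempotents,
    since [e + e y (1 - e)] is idempotent for every [y]; the hypothesis on the
    diagonal corners makes each of their elements a product of two
    off-diagonal ones. *)
Lemma idempotent_generated_peirce (M : pzRingType) (I : finType) (e : I -> M) :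
    \sum_i e i = 1 ->
    (forall i j, i != j -> e i * e j = 0) ->
    (forall i, exists2 j, i != j &
       forall x, exists a b, e i * x * e i = e i * a * e j * b * e i) ->
  idempotent_generated M.
Proof.
move=> e1 eij diag Z ZB ZM Zid.
have Z0 : Z 0 by apply: Zid; rewrite mulr0.
have ZD x y : Z x -> Z y -> Z (x + y).
  by move=> Zx Zy; rewrite -[y]opprK -[- y]sub0r; apply: (ZB) => //; apply: ZB.
have eii i : e i * e i = e i.
  rewrite -[RHS]mulr1 -e1 mulr_sumr (bigD1 i)//= big1 ?addr0// => j ji.
  by rewrite eij// eq_sym.
have offdiag i j x : i != j -> Z (e i * x * e j).
  move=> ij; set y := e i * x * e j.
  have eiy : e i * y = y by rewrite /y !mulrA eii.
  have yei : y * e i = 0 by rewrite /y -mulrA eij ?mulr0// eq_sym.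
  have yy : y * y = 0 by rewrite -{2}eiy mulrA yei mul0r.
  have -> : y = (e i + y) - e i by rewrite addrC addKr.
  apply: ZB; apply: Zid => //.
  by rewrite mulrDl !mulrDr eii eiy yei yy !addr0.
have corner i j x : Z (e i * x * e j).
  have [<-|/offdiag//] := eqVneq i j.
  have [k ik /(_ x)[a [b ->]]] := diag i.
  have -> : e i * a * e k * b * e i = (e i * a * e k) * (e k * b * e i).
    by rewrite !mulrA -[_ * e k * e k]mulrA eii.
  by apply: ZM; apply: offdiag => //; rewrite eq_sym.
move=> x; rewrite -[x]mul1r -[_ * x]mulr1 -e1 mulr_suml mulr_suml.
apply: (big_ind Z) => // i _; rewrite mulr_sumr.
by apply: (big_ind Z).
Qed.

(** For an idempotent [e], the products [(x e) ((1 - e) y)] and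
    [(x (1 - e)) (e y)] vanish, hence [psi (x e) y = psi (x e) (e y) =
    psi x (e y)]; the elements that can be moved across the comma in this way
    form a subring. *)
Lemma zero_product_balanced (M : pzRingType) (V : zmodType) (psi : M -> M -> V) :
    idempotent_generated M ->
    (forall y, zmod_morphism (psi ^~ y)) -> (forall x, zmod_morphism (psi x)) ->
    (forall x y, x * y = 0 -> psi x y = 0) ->
  forall x z y, psi (x * z) y = psi x (z * y).
Proof.
move=> genM psil psir psi0 x z y.
move: z x y; apply: genM => [z t zP tP x y|z t zP tP x y|e ee x y].
- by rewrite mulrBr mulrBl psil psir /= zP tP.
- by rewrite mulrA tP zP mulrA.
- have l : psi (x * e) (y - e * y) = 0.
    by apply: psi0; rewrite mulrBr mulrA -[x * e * e]mulrA ee subrr.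
  have r : psi (x - x * e) (e * y) = 0.
    by apply: psi0; rewrite mulrBl !mulrA -[x * e * e]mulrA ee subrr.
  move: l r; rewrite psir psil /= => /eqP; rewrite subr_eq0 => /eqP ->.
  by move=> /eqP; rewrite subr_eq0 => /eqP.
Qed.

(** * Iterated commutators *)

Section Commutators.
Variable U : pzRingType.
Implicit Types (a b : U) (s : seq U).

Lemma lieBl b : zmod_morphism ((@lie U)^~ b).
Proof. by move=> x y; rewrite /lie mulrBl mulrBr opprD addrACA -opprD. Qed.

Lemma lieC a b : lie a b = - lie b a.
Proof. by rewrite /lie opprB. Qed.

Lemma lieBr a : zmod_morphism (@lie U a).
Proof. by move=> x y; rewrite ![lie a _]lieC lieBl opprB opprK addrC. Qed.

Lemma lie1r a : lie a 1 = 0.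
Proof. by rewrite /lie mulr1 mul1r subrr. Qed.

Lemma lie1l a : lie 1 a = 0.
Proof. by rewrite lieC lie1r oppr0. Qed.

Lemma foldl_lieB s : zmod_morphism (fun a => foldl (@lie U) a s).
Proof. by elim: s => [//|c s IHs] a b /=; rewrite lieBl IHs. Qed.

Lemma foldl_lie0 s : foldl (@lie U) 0 s = 0.
Proof. by have := foldl_lieB s 0 0; rewrite !subrr. Qed.

Lemma foldl_lieN s a : foldl (@lie U) (- a) s = - foldl (@lie U) a s.
Proof. by rewrite -sub0r foldl_lieB foldl_lie0 sub0r. Qed.

End Commutators.

Section ConditionsOnZeroProducts.
Variables (U : pzRingType) (n : nat) (phi : {additive U -> U}).

Lemma lie_centralizer_r : lie_centralizer n phi ->
  forall a b (s : (n - 2).-tuple U),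
    phi (lie_p [:: a, b & s]) = lie_p [:: a, phi b & s].
Proof.
move=> cphi a b s.
rewrite /= lieC [in RHS]lieC !foldl_lieN raddfN.
by congr (- _); apply: cphi.
Qed.

Lemma lie_centralizer_N : lie_centralizer n phi -> cond_N n phi.
Proof. by move=> cphi; split=> a b s _ //; apply: lie_centralizer_r. Qed.

Lemma lie_centralizer_T : lie_centralizer n phi -> cond_T n phi.
Proof. by move=> cphi; split=> a b s _ //; apply: lie_centralizer_r. Qed.

Lemma cond_Nl_Tl : cond_Nl n phi -> cond_Tl n phi.
Proof. by move=> Nphi a b s ab; apply: Nphi; rewrite !big_cons mulrA ab mul0r. Qed.

Lemma cond_Nr_Tr : cond_Nr n phi -> cond_Tr n phi.
Proof. by move=> Nphi a b s ab; apply: Nphi; rewrite !big_cons mulrA ab mul0r. Qed.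

(** The defect [psi a b] of the identity vanishes on zero products, so that
    [psi a b = psi (a b) 1], and [psi _ 1] is zero since it only involves
    commutators with [1]. *)
Lemma cond_Tl_lie_centralizer :
  idempotent_generated U -> cond_Tl n phi -> lie_centralizer n phi.
Proof.
move=> genU Tphi a b s; apply/eqP; rewrite -subr_eq0 /=; apply/eqP.
pose psi a b :=
  phi (foldl (@lie U) (lie a b) s) - foldl (@lie U) (lie (phi a) b) s.
have psil y : zmod_morphism (psi^~ y).
  by move=> x z; rewrite /psi raddfB !lieBl !foldl_lieB raddfB opprD addrACA -opprD.
have psir x : zmod_morphism (psi x).
  by move=> y z; rewrite /psi !lieBr !foldl_lieB raddfB opprD addrACA -opprD.
have psi0 x y : x * y = 0 -> psi x y = 0.
  by move=> xy; apply/eqP; rewrite subr_eq0; apply/eqP/Tphi.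
have := zero_product_balanced genU psil psir psi0 a b 1.
by rewrite mulr1 /psi => <-; rewrite !lie1r !foldl_lie0 raddf0 subrr.
Qed.

(** Here the defect satisfies [psi a b = psi 1 (a b) = 0]. *)
Lemma cond_Tr_lie_centralizer :
  idempotent_generated U -> cond_Tr n phi -> lie_centralizer n phi.
Proof.
move=> genU Tphi.
pose psi s a b :=
  phi (foldl (@lie U) (lie a b) s) - foldl (@lie U) (lie a (phi b)) s.
have psi0 (s : (n - 2).-tuple U) a b : psi s a b = 0.
  have psil y : zmod_morphism (psi s ^~ y).
    by move=> x z; rewrite /psi !lieBl !foldl_lieB raddfB opprD addrACA -opprD.
  have psir x : zmod_morphism (psi s x).
    by move=> y z; rewrite /psi raddfB !lieBr !foldl_lieB raddfB opprD addrACA -opprD.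
  have psi0 x y : x * y = 0 -> psi s x y = 0.
    by move=> xy; apply/eqP; rewrite subr_eq0; apply/eqP/Tphi.
  have := zero_product_balanced genU psil psir psi0 1 a b.
  by rewrite mul1r => ->; rewrite /psi !lie1l !foldl_lie0 raddf0 subrr.
move=> a b s /=; rewrite lieC foldl_lieN raddfN [in RHS]lieC foldl_lieN.
by congr (- _); apply/eqP; rewrite -subr_eq0; apply/eqP/psi0.
Qed.

End ConditionsOnZeroProducts.

(** * Bounded operators on an inner product space *)

HB.instance Definition _ (K : numFieldType) (V : normedModType K)
    (A : bounded_operator V) :=
  GRing.isLinear.Build K V V *:%R A (proj1 (bounded_operatorP A)).

(** If every vector of [S] is an eigenvector of [g], comparing the eigenvalues
    of [x], [y] and [x + y] shows that they are all equal. *)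
Lemma eigen_everywhere (K : fieldType) (V : lmodType K) (g : {linear V -> V})
    (S : V -> Prop) :
    (forall x y, S x -> S y -> S (x + y)) ->
    (forall x, S x -> exists c, g x = c *: x) ->
  exists c, forall x, S x -> g x = c *: x.
Proof.
move=> SD gS; have [[y [Sy y0]]|noS] := pselect (exists y, S y /\ y != 0); last first.
  exists 0 => x Sx; have [->|x0] := eqVneq x 0; first by rewrite linear0 scaler0.
  by case: noS; exists x.
have [c gy] := gS y Sy; exists c => x Sx.
have [d gx] := gS x Sx; have [e gxy] := gS (x + y) (SD x y Sx Sy).
have /eqP : (d - e) *: x = (e - c) *: y.
  apply/eqP; rewrite !scalerBl subr_eq addrAC -subr_eq opprK -gx -gy -linearD gxy.
  by rewrite scalerDr addrC.
have [->|ec] := eqVneq e c.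
  rewrite subrr scale0r scaler_eq0 subr_eq0 gx => /orP[/eqP->//|/eqP->].
  by rewrite !scaler0.
rewrite -subr_eq0 in ec; move=> /eqP/(congr1 ( *:%R (e - c)^-1)).
rewrite !scalerA mulVf// scale1r; set k := _ * _ => yx.
move: gy y0; rewrite -yx linearZ/= gx scaler_eq0 negb_or => + /andP[k0 _].
by rewrite !scalerA [c * k]mulrC -!(scalerA k); move/(scalerI k0).
Qed.

Lemma free_neq0 (K : fieldType) (V : lmodType K) k (v : 'I_k -> V) :
    (forall c : 'I_k -> K, \sum_(i < k) c i *: v i = 0 -> forall i, c i = 0) ->
  forall i, v i != 0.
Proof.
move=> v_free i; apply/eqP => vi0.
have sum0 : \sum_(j < k) (j == i)%:R *: v j = 0.
  by apply: big1 => j _; case: eqVneq => [->|_]; rewrite ?vi0 ?scaler0 ?scale0r.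
by have := v_free _ sum0 i; rewrite eqxx => /eqP; rewrite oner_eq0.
Qed.

Section InnerProduct.
Variables (C : numClosedFieldType) (H : normedModType C).
Variable inner : {dot H for Num.conj}.
Hypothesis inner_norm : forall x : H, inner x x = `|x| ^+ 2.
Implicit Types x y z u v w : H.

Local Notation "'[ x , y ]" := (inner x y).

Lemma innerC x y : '[x, y] = ('[y, x])^*.
Proof. by rewrite hermC expr0 mul1r. Qed.

Lemma inner_eq0C x y : '[x, y] = 0 -> '[y, x] = 0.
Proof. by rewrite innerC => /eqP; rewrite conjC_eq0 => /eqP. Qed.

Lemma inner_eq0 x : ('[x, x] == 0) = (x == 0).
Proof. by rewrite inner_norm sqrf_eq0 normr_eq0. Qed.

(** Pythagoras for the orthogonal projection of [x] on the line of [y]. It gives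
    the Cauchy-Schwarz inequality, and measures how much a non-orthogonal
    direction improves an approximation of [x]. *)
Lemma normB_proj x y : y != 0 ->
  `|x - ('[x, y] / `|y| ^+ 2) *: y| ^+ 2 = `|x| ^+ 2 - `|'[x, y]| ^+ 2 / `|y| ^+ 2.
Proof.
move=> y0.
rewrite -!inner_norm linearBl !linearBr/= !linearZl_LR !linearZr_LR/=.
rewrite [in X in _ + X](innerC y x) !inner_norm !rmorphM/= fmorphV/=.
have -> : (`|y| ^+ 2)^* = `|y| ^+ 2 by rewrite conj_Creal// rpredX// normr_real.
by rewrite normCK; field; rewrite normr_eq0.
Qed.

Lemma cauchy_schwarz x y : `|'[x, y]| <= `|x| * `|y|.
Proof.
have [->|y0] := eqVneq y 0; first by rewrite linear0r !normr0 mulr0.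
rewrite -(@ler_pXn2r _ 2)// ?nnegrE ?mulr_ge0// exprMn.
rewrite -ler_pdivrMr ?exprn_gt0 ?normr_gt0// -subr_ge0 -normB_proj//.
by rewrite exprn_ge0.
Qed.

Fact rank1_subproof u w :
  (fun x => '[x, w] *: u) \in @bounded_operator_pred C H.
Proof.
apply/asboolP; split=> [a x y|]; first by rewrite linearPl /= scalerDl scalerA.
exists (`|w| * `|u|) => x.
by rewrite normrZ mulrAC ler_wpM2r// mulrC cauchy_schwarz.
Qed.

Definition rank1 u w : bounded_operator H :=
  BoundedOperator (rank1_subproof u w).

Lemma rank1E u w x : rank1 u w x = '[x, w] *: u.
Proof. by []. Qed.

(** * Maps commuting with commutators *)

Local Notation "A %:op" := (A *: (1 : bounded_operator H)) (at level 2).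

(** Evaluate the commutator at [u] itself. *)
Lemma lie_rank1_eigen (A : bounded_operator H) u c :
  lie A (rank1 u u) = c %:op -> exists d, A u = d *: u.
Proof.
have [->|u0] := eqVneq u 0; first by exists 0; rewrite linear0 scaler0.
move=> /(congr1 (fun B : bounded_operator H => B u)).
rewrite [LHS]/= /lie -[LHS]/(A ('[u, u] *: u) - '[A u, u] *: u).
rewrite -[RHS]/(c *: u) linearZ/= => /eqP; rewrite subr_eq -scalerDl => /eqP.
move=> /(congr1 ( *:%R ('[u, u])^-1)).
rewrite !scalerA mulVf ?inner_eq0// scale1r => ->.
by eexists.
Qed.

Lemma operator_eigen_scalar (A : bounded_operator H) :
  (forall x, exists c, A x = c *: x) -> exists c, A = c %:op.
Proof.
move=> eigA; have [//||c Ac] := @eigen_everywhere _ _ A (fun=> True).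
  by move=> x _; apply: eigA.
by exists c; apply: bounded_operator_eq => x; rewrite Ac.
Qed.

(** If all commutators [lie A B] are scalar, then so is [A], by the case where
    [B] has rank one; this removes the iterated commutators one at a time. *)
Lemma foldl_lie_eq0_scalar k (A : bounded_operator H) :
  (forall s, size s = k -> foldl (@lie _) A s = 0) -> exists c, A = c %:op.
Proof.
elim: k A => [|k IHk] A As0.
  by exists 0; rewrite scale0r; apply: (As0 [::]).
apply: operator_eigen_scalar => u.
have [|c] := IHk (lie A (rank1 u u)).
  by move=> s sk; apply: (As0 (rank1 u u :: s)) => /=; rewrite sk.
exact: lie_rank1_eigen.
Qed.

Section CommutingMap.
Variable phi : {linear bounded_operator H -> bounded_operator H}.
Hypothesis phi_lie : forall A B : bounded_operator H,
  exists c, lie (phi A) B - lie A (phi B) = c %:op.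

Local Notation th u := (rank1 u u).

(** The hypothesis on [phi] evaluated at a vector, with all signs positive. *)
Lemma phi_lieE (A B : bounded_operator H) : exists c, forall x,
  phi A (B x) + phi B (A x) = c *: x + B (phi A x) + A (phi B x).
Proof.
have [c AB] := phi_lie A B; exists c => x.
have := congr1 (fun D : bounded_operator H => D x) AB.
rewrite -[LHS]/(phi A (B x) - B (phi A x) - (A (phi B x) - phi B (A x))).
rewrite -[RHS]/(c *: x) => <-.
by rewrite opprB addrA [RHS]addrAC subrK [RHS]addrAC subrK.
Qed.

(** Take both operators equal to [th u] and evaluate at [u]. *)
Lemma phi_rank1_eigen u : exists c, phi (th u) u = c *: u.
Proof.
have [->|u0] := eqVneq u 0; first by exists 0; rewrite linear0 scaler0.
have [c /(_ u)] := phi_lieE (th u) (th u).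
rewrite !rank1E linearZ/= -!scalerDl => uu.
have u2 : '[u, u] + '[u, u] != 0 by rewrite -mulr2n mulrn_eq0/= inner_eq0.
by exists ((c + '[phi (th u) u, u] + '[phi (th u) u, u]) / ('[u, u] + '[u, u]));
  rewrite mulrC -scalerA -uu scalerA mulVf// scale1r.
Qed.

(** Take [th y] and [th u] and evaluate at [y]: [phi (th y) y] is a multiple of
    [y], which [th u] kills, so that only multiples of [y] remain. *)
Lemma phi_rank1_eigen_ortho u y :
  '[y, u] = 0 -> exists c, phi (th u) y = c *: y.
Proof.
move=> yu; have [->|y0] := eqVneq y 0; first by exists 0; rewrite linear0 scaler0.
have [d phiy] := phi_rank1_eigen y.
have [c /(_ y)] := phi_lieE (th y) (th u).
rewrite !rank1E phiy linearZl_LR/= yu mulr0 !scale0r linear0 add0r addr0.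
rewrite linearZ/= -scalerDl => yy.
by exists ((c + '[phi (th u) y, y]) / '[y, y]);
  rewrite mulrC -scalerA -yy scalerA mulVf ?inner_eq0// scale1r.
Qed.

(** This [l] turns out to be the factor by which [phi] scales every operator,
    modulo scalar operators. *)
Definition rank1_coef u l :=
  exists b, forall x, phi (th u) x = (l * '[x, u]) *: u + b *: x.

(** [phi (th u)] is a scalar on the orthogonal complement of [u], where every
    vector is an eigenvector, and has [u] as another eigenvector. *)
Lemma rank1_coef_ex u : u != 0 -> exists l, rank1_coef u l.
Proof.
move=> u0; have uu : '[u, u] != 0 by rewrite inner_eq0.
have [a phiu] := phi_rank1_eigen u.
have [||b phib] := @eigen_everywhere _ _ (phi (th u)) (fun y => '[y, u] = 0).
- by move=> x y xu yu; rewrite linearDl/= xu yu addr0.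
- by move=> y; apply: phi_rank1_eigen_ortho.
exists ((a - b) / '[u, u]); exists b => x.
pose t := '[x, u] / '[u, u].
have xu : '[x - t *: u, u] = 0 by rewrite linearBl/= linearZl_LR/= mulfVK ?subrr.
have -> : phi (th u) x = phi (th u) (x - t *: u) + t *: phi (th u) u.
  by rewrite -linearZ -linearD subrK.
rewrite (phib _ xu) phiu.
rewrite scalerBr !scalerA -addrA [- _ + _]addrC -scalerBl [RHS]addrC; congr (_ + _ *: _).
by rewrite /t; field.
Qed.

(** Compare [phi A] with [phi (th u)] and evaluate at [u]: the scalar part of
    [phi (th u)] cancels. *)
Lemma rank1_coef_eigen u l : u != 0 -> rank1_coef u l ->
  forall A, exists c, phi A u = l *: A u + c *: u.
Proof.
move=> u0 [b phiu] A; have uu : '[u, u] != 0 by rewrite inner_eq0.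
have [c /(_ u)] := phi_lieE A (th u).
rewrite !rank1E !phiu linearD !linearZ/= !addrA => /addIr/eqP.
rewrite eq_sym -subr_eq -scalerDl addrAC -scalerBl => /eqP/esym.
move=> /(congr1 ( *:%R ('[u, u])^-1)).
rewrite scalerDr !scalerA mulVf// scale1r => ->.
by rewrite [_ * (l * _)]mulrC mulfK// addrC; eexists.
Qed.

(** Comparing [phi] at the two rank one operators gives
    [(m - l) |u|^2 <u, w> w] in the line spanned by [u]. *)
Lemma rank1_coef_eq u w l m : '[u, w] != 0 -> (forall k, w != k *: u) ->
  rank1_coef u l -> rank1_coef w m -> m = l.
Proof.
move=> uw wNu [b phiu] [d phiw].
have u0 : u != 0 by apply: contra_neq uw => ->; rewrite linear0l.
have uu : '[u, u] != 0 by rewrite inner_eq0.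
have [c /(_ u)] := phi_lieE (th w) (th u).
have -> : phi (th w) (th u u) = ('[u, u] * m * '[u, w]) *: w + ('[u, u] * d) *: u.
  by rewrite rank1E linearZ/= phiw scalerDr !scalerA mulrA.
have -> : phi (th u) (th w u) =
    ('[u, w] * l * '[w, u]) *: u + ('[u, w] * b) *: w.
  by rewrite rank1E linearZ/= phiu scalerDr !scalerA mulrA.
have -> : th w (phi (th u) u) = ((l * '[u, u] + b) * '[u, w]) *: w.
  by rewrite phiu -scalerDl rank1E linearZl_LR.
rewrite rank1E; set x := '[phi (th w) u, u].
rewrite [in LHS](addrC (_ *: u) (_ *: w)) addrACA -!scalerDl => /eqP.
rewrite -subr_eq addrAC -scalerBl eq_sym -subr_eq -scalerBl.
have -> : '[u, u] * m * '[u, w] + '[u, w] * b - (l * '[u, u] + b) * '[u, w] =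
    '[u, u] * '[u, w] * (m - l) by ring.
set k := (k in k *: u) => /eqP ku; apply/eqP; apply: contraT => ml.
have e0 : '[u, u] * '[u, w] * (m - l) != 0.
  by rewrite !mulf_neq0// subr_eq0.
have /eqP[] := wNu ((('[u, u] * '[u, w] * (m - l))^-1 * k)).
by rewrite -scalerA ku scalerA mulVf// scale1r.
Qed.

(** If [w] is orthogonal to [u], then [u + w] is orthogonal to neither. *)
Lemma rank1_coef_indep u w l : u != 0 -> (forall k, w != k *: u) ->
  rank1_coef u l -> rank1_coef w l.
Proof.
move=> u0 wNu ul; have uu : '[u, u] != 0 by rewrite inner_eq0.
have w0 : w != 0 by have := wNu 0; rewrite scale0r.
have [m wm] := rank1_coef_ex w0.
have [/eqP uw|uw] := boolP ('[u, w] == 0); last first.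
  by rewrite -(rank1_coef_eq uw wNu ul wm).
have wu : '[w, u] = 0 by apply: inner_eq0C.
have ww : '[w, w] != 0 by rewrite inner_eq0.
have uwNu k : u + w != k *: u.
  apply: contra_neq (wNu (k - 1)) => uwk.
  by rewrite scalerBl scale1r -uwk addrAC subrr add0r.
have uw0 : u + w != 0 by have := uwNu 0; rewrite scale0r.
have [p uwp] := rank1_coef_ex uw0.
have pl : p = l.
  apply: rank1_coef_eq uwNu ul uwp.
  by rewrite linearDr/= uw addr0.
rewrite -pl -(@rank1_coef_eq (u + w) w p m)//.
  by rewrite linearDl/= uw add0r.
move=> k; apply/eqP => wk.
have k0 : k = 0.
  apply/eqP; have := congr1 (fun x => '[x, u]) wk.
  rewrite wu linearZl_LR/= linearDl/= wu addr0 => /esym/eqP.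
  by rewrite mulf_eq0 (negPf uu) orbF.
by move: w0; rewrite wk k0 scale0r eqxx.
Qed.

(** The coefficient [l] of one vector serves for all: every vector is an
    eigenvector of [phi A - l A], whose scalar is then read off at [u], which
    makes it linear in [A]. *)
Lemma commuting_map_scalar u : u != 0 ->
  exists l (mu : {scalar bounded_operator H}),
    forall A, phi A = l *: A + (mu A) %:op.
Proof.
move=> u0; have [l ul] := rank1_coef_ex u0.
have uu : '[u, u] != 0 by rewrite inner_eq0.
have eigen A x : exists c, (phi A - l *: A) x = c *: x.
  have [[k ->]|xNu] := pselect (exists k, x = k *: u).
    have [c phiA] := rank1_coef_eigen u0 ul A; exists c.
    have -> : (phi A - l *: A) (k *: u) = k *: (phi A u - l *: A u).
      by rewrite -[RHS]/(k *: (phi A - l *: A) u) -linearZ.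
    by rewrite phiA addrAC subrr add0r !scalerA mulrC.
  have xNu' k : x != k *: u by apply/eqP => xu; apply: xNu; exists k.
  have x0 : x != 0 by have := xNu' 0; rewrite scale0r.
  have [c phiA] := rank1_coef_eigen x0 (rank1_coef_indep u0 xNu' ul) A; exists c.
  by rewrite -[LHS]/(phi A x - l *: A x) phiA addrAC subrr add0r.
pose mu A := '[(phi A - l *: A) u, u] / '[u, u].
have mu_lin : scalar mu.
  move=> a A B; rewrite /mu mulrA -mulrDl; congr (_ / _).
  rewrite linearP scalerDr opprD addrACA scalerA [l * a]mulrC -scalerA -scalerBr.
  by rewrite -linearPl.
pose muL : {scalar bounded_operator H} :=
  HB.pack mu (GRing.isLinear.Build _ _ _ _ mu mu_lin).
exists l, muL => A /=.
have [c phiA] := operator_eigen_scalar (eigen A).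
rewrite -{1}[phi A](subrK (l *: A)) addrC; congr (_ + _).
rewrite /mu phiA -[(c %:op) u]/(c *: u) linearZl_LR/= mulfK//.
Qed.

End CommutingMap.

(** The two terms have the same iterated commutators with any [s], both being
    [phi (lie_p [:: A, B & s])]. *)
Lemma lie_centralizer_commuting n
    (phi : {linear bounded_operator H -> bounded_operator H}) :
  lie_centralizer n phi ->
  forall A B, exists c, lie (phi A) B - lie A (phi B) = c %:op.
Proof.
move=> cphi A B; apply: (@foldl_lie_eq0_scalar (n - 2)) => s /eqP sn.
rewrite foldl_lieB; apply/eqP; rewrite subr_eq0; apply/eqP.
have := cphi A B (Tuple sn); rewrite (lie_centralizer_r cphi)/=.
by move=> ->.
Qed.

End InnerProduct.

(** * Halving a Hilbert space *)

Section Halving.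
Variables (R : realType) (H : completeNormedModType R[i]).
Variable inner : {dot H for Num.conj}.
Hypothesis inner_norm : forall x : H, inner x x = `|x| ^+ 2.
Implicit Types (x y z u d : H) (p q : H * H) (G : set (H * H)).

Local Notation "'[ x , y ]" := (inner x y).
Local Notation inner_eq0 := (inner_eq0 inner_norm).
Local Notation cauchy_schwarz := (cauchy_schwarz inner_norm).

Lemma complex_archimedean (a : R[i]) : 0 <= a -> exists N : nat, a <= N%:R.
Proof.
move=> a0; have aR : (complex.Re a)%:C%C = a by rewrite RRe_real// ger0_real.
exists (Num.bound (complex.Re a)); rewrite -{1}aR.
rewrite -[leRHS](rmorph_nat (real_complex R)) lecR ltW// archi_boundP//.
by rewrite -ler0c aR.
Qed.

Lemma small_eq0 (c k : R[i]) : 0 <= k ->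
  (forall e, 0 < e -> `|c| <= e * k) -> c = 0.
Proof.
move=> k0 ck; apply/eqP/contraT => c0.
have k1 : 0 < k + 1 by rewrite ltr_wpDl.
have := ck (`|c| / (k + 1)).
rewrite divr_gt0 ?normr_gt0// => /(_ isT).
rewrite mulrAC ler_pdivlMr// ler_pM2l ?normr_gt0//.
by rewrite gerDl ler10.
Qed.

Lemma natV_small (e : R[i]) : 0 < e ->
  exists N, forall i, (N <= i)%N -> i.+1%:R^-1 <= e.
Proof.
move=> e0; have eV : 0 < e^-1 by rewrite invr_gt0.
have [N eN] := complex_archimedean (ltW eV).
exists N => i Ni; rewrite -[leRHS]invrK lef_pV2 ?posrE ?ltr0n//.
by rewrite (le_trans eN)// ler_nat leqW.
Qed.

(** Completeness of [H] in terms of sequences with an explicit Cauchy rate. *)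
Lemma cauchy_rate_limit (u : nat -> H) :
    (forall i j, `|u i - u j| <= i.+1%:R^-1 + j.+1%:R^-1) ->
  exists l, forall e : R[i], 0 < e ->
    exists N, forall i, (N <= i)%N -> `|l - u i| <= e.
Proof.
move=> cu.
have : cvg (u @ \oo)%classic.
  apply/cauchy_cvgP/cauchy_exP => e e0.
  have [N Ne] := natV_small (divr_gt0 e0 (ltr0Sn _ 2)).
  exists (u N); exists N => // i /= Ni.
  rewrite -ball_normE /= (le_lt_trans (cu _ _))//.
  rewrite (le_lt_trans (lerD (Ne _ (leqnn _)) (Ne _ Ni)))//.
  have e3 : e = e / 3 + e / 3 + e / 3 by field.
  by rewrite [ltRHS]e3 ltrDl divr_gt0.
move=> /cvg_ex[l ul]; exists l => e e0.
by have /cvgrPdist_le/(_ e e0)[N _ Nl] := ul; exists N.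
Qed.


(** A relation on [H] that is the graph of a linear isometry between subspaces.
    Nonemptiness is left out so that the union of an empty chain qualifies. *)
Definition isometry_graph G :=
  (forall a p q, G p -> G q -> G (a *: p + q)) /\
  (forall p q, G p -> G q -> '[p.1, q.1] = '[p.2, q.2]).

Definition adherent G p :=
  forall e : R[i], 0 < e -> exists q, [/\ G q, `|p.1 - q.1| <= e & `|p.2 - q.2| <= e].

Definition graph_closed G := forall p, adherent G p -> G p.

Lemma graph0 G p : isometry_graph G -> G p -> G 0.
Proof. by move=> [lG _] Gp; have := lG (-1) p p Gp Gp; rewrite scaleN1r addNr. Qed.

Lemma graphB G p q : isometry_graph G -> G p -> G q -> G (p - q).
Proof. by move=> [lG _] Gp Gq; have := lG (-1) q p Gq Gp; rewrite scaleN1r addrC. Qed.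

Lemma graph_norm G p : isometry_graph G -> G p -> `|p.1| = `|p.2|.
Proof.
move=> [_ isoG] Gp; apply/eqP; rewrite -(@eqrXn2 _ 2)//.
by rewrite -!inner_norm isoG.
Qed.

(** A vector at which the error [|<x - p.1, q.1>|] exceeds [e |q.1|] allows to
    decrease the squared distance from [x] to the domain by [e ^ 2], which can
    only be done finitely often. *)
Lemma approx_proj G x e : isometry_graph G -> G 0 -> 0 < e ->
  exists p, G p /\ forall q, G q -> `|'[x - p.1, q.1]| <= e * `|q.1|.
Proof.
move=> gG G0 e0; have lG := proj1 gG.
have [N xN] := complex_archimedean (exprn_ge0 2 (normr_ge0 (e^-1 *: x))).
have {xN} : `|x - (0 : H * H).1| ^+ 2 <= N%:R * e ^+ 2.
  move: xN; rewrite normrZ exprMn gtr0_norm ?invr_gt0// exprVn subr0.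
  by rewrite mulrC ler_pdivrMr// exprn_gt0.
elim: N (0 : H * H) G0 => [|N IHN] p Gp.
  rewrite mul0r => xp; have {}xp : x - p.1 = 0.
    by apply/eqP; rewrite -normr_eq0 -sqrf_eq0 eq_le xp exprn_ge0.
  by exists p; split=> // q Gq; rewrite xp linear0l normr0 mulr_ge0// ltW.
move=> xp; have [[q [Gq qe]]|noq] := pselect (exists q, G q /\
    ~ `|'[x - p.1, q.1]| <= e * `|q.1|); last first.
  exists p; split=> // q Gq; apply: contrapT => qe; apply: noq; by exists q.
have eqR : e * `|q.1| \is Num.real by rewrite ger0_real// mulr_ge0// ltW.
move: qe => /negP; rewrite -real_ltNge ?normr_real// => qe.
have q0 : q.1 != 0.
  by apply: contraTneq qe => ->; rewrite linear0r !normr0 mulr0 ltxx.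
pose t := '[x - p.1, q.1] / `|q.1| ^+ 2.
apply: (IHN (t *: q + p)); first exact: lG.
have -> : x - (t *: q + p).1 = (x - p.1) - t *: q.1.
  by rewrite /= opprD addrCA addrC.
rewrite normB_proj// lerBlDr (le_trans xp)// -natr1 mulrDl mul1r lerD2l.
rewrite ler_pdivlMr ?exprn_gt0// ?normr_gt0// -exprMn.
by rewrite ler_pXn2r ?nnegrE ?mulr_ge0// ltW.
Qed.

(** Two approximate projections of [x] at rates [a] and [b] are at distance at
    most [a + b], so that they form a Cauchy sequence. *)
Lemma graph_projection G x : isometry_graph G -> graph_closed G -> G 0 ->
  exists p, G p /\ forall q, G q -> '[x - p.1, q.1] = 0.
Proof.
move=> gG cG G0.
have rate0 k : 0 < k.+1%:R^-1 :> R[i] by rewrite invr_gt0 ltr0n.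
have /choice[u uP] k := @approx_proj G x (k.+1%:R^-1) gG G0 (rate0 k).
have Gu k : G (u k) by case: (uP k).
have cu1 i j : `|(u i).1 - (u j).1| <= i.+1%:R^-1 + j.+1%:R^-1.
  set d := _ - _; have Gd : G (u i - u j) by apply: graphB.
  have [->|d0] := eqVneq d 0; first by rewrite normr0 ltW// addr_gt0.
  rewrite -(@ler_pM2r _ `|d|) ?normr_gt0// -expr2 -inner_norm.
  have dd : '[d, d] = '[x - (u j).1, d] - '[x - (u i).1, d].
    have -> : '[d, d] = '[(x - (u j).1) - (x - (u i).1), d].
      by rewrite opprB addrC addrA subrK.
    by rewrite linearBl.
  have dd0 : 0 <= '[d, d] by rewrite inner_norm exprn_ge0.
  have [_ /(_ _ Gd) ui] := uP i; have [_ /(_ _ Gd) uj] := uP j.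
  by rewrite -(ger0_norm dd0) dd (le_trans (ler_normB _ _))// addrC mulrDl lerD.
have cu2 i j : `|(u i).2 - (u j).2| <= i.+1%:R^-1 + j.+1%:R^-1.
  by rewrite -(graph_norm gG (graphB gG (Gu i) (Gu j))); apply: cu1.
have [d ud] := cauchy_rate_limit cu1; have [y uy] := cauchy_rate_limit cu2.
exists (d, y); split=> [|q Gq].
  apply: cG => e e0; have [N Nd] := ud e e0; have [M My] := uy e e0.
  by exists (u (maxn N M)); rewrite Nd ?leq_maxl// My ?leq_maxr.
apply: (@small_eq0 _ (`|q.1| + `|q.1|)); first by rewrite addr_ge0.
move=> e e0; have [N Nd] := ud e e0.
have [M Me] := natV_small e0; set k := maxn N M.
rewrite -[x](subrK (u k).1) -addrA linearDl/= mulrDr.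
rewrite (le_trans (ler_normD _ _))// lerD//.
  have [_ /(_ q Gq) xu] := uP k.
  by rewrite (le_trans xu)// ler_wpM2r// Me// leq_maxr.
rewrite (le_trans (cauchy_schwarz _ _))// ler_wpM2r// distrC.
by rewrite Nd// leq_maxl.
Qed.

(** The linear isometry with graph [G], extended by zero on the orthogonal
    complement of its domain. *)
Lemma graph_operator G : isometry_graph G -> graph_closed G -> G 0 ->
  exists v : bounded_operator H, forall x, exists d,
    G (d, v x) /\ forall q, G q -> '[x - d, q.1] = 0.
Proof.
move=> gG cG G0; have [lG isoG] := gG.
have /choice[pr prP] x := graph_projection x gG cG G0.
have pr_uniq x p : G p -> (forall q, G q -> '[x - p.1, q.1] = 0) -> p = pr x.
  move=> Gp px; have [Gpr prx] := prP x.
  have Gd : G (p - pr x) by apply: graphB.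
  have d1 : (p - pr x).1 = 0.
    have rE : (p - pr x).1 = (x - (pr x).1) - (x - p.1).
      by rewrite opprB [RHS]addrC addrA subrK.
    by apply/eqP; rewrite -inner_eq0 {1}rE linearBl/= (px _ Gd) (prx _ Gd) subrr.
  have d2 : (p - pr x).2 = 0.
    by apply/eqP; rewrite -normr_eq0 -(graph_norm gG Gd) d1 normr0.
  by apply/eqP; rewrite -subr_eq0 [p - _]surjective_pairing d1 d2.
have pr_lin a x y : pr (a *: x + y) = a *: pr x + pr y.
  have [[Gx xP] [Gy yP]] := (prP x, prP y).
  apply/esym/pr_uniq; first exact: lG.
  move=> q Gq; have -> : a *: x + y - (a *: pr x + pr y).1 =
      a *: (x - (pr x).1) + (y - (pr y).1).
    by rewrite /= opprD addrACA scalerBr.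
  by rewrite linearPl/= (xP _ Gq) (yP _ Gq) mulr0 addr0.
have v_bounded : (fun x => (pr x).2) \in @bounded_operator_pred R[i] H.
  apply/asboolP; split=> [a x y|]; first by rewrite pr_lin.
  exists 1 => x; rewrite mul1r; have [Gx xP] := prP x.
  rewrite -(graph_norm gG Gx); set d := (pr x).1.
  have [->|d0] := eqVneq d 0; first by rewrite normr0.
  rewrite -(@ler_pM2r _ `|d|) ?normr_gt0// -expr2 -inner_norm.
  have dx : '[d, d] = '[x, d].
    by apply/eqP; rewrite eq_sym -subr_eq0 -linearBl/= (xP _ Gx).
  have dd0 : 0 <= '[d, d] by rewrite inner_norm exprn_ge0.
  by rewrite -(ger0_norm dd0) dx cauchy_schwarz.
exists (BoundedOperator v_bounded) => x; exists (pr x).1 => /=.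
by have [Gx xP] := prP x; rewrite -surjective_pairing.
Qed.

(** Apply the extension by zero to [G] and to its transpose: [w] is the adjoint
    of [v], [w v] is the projection onto the domain of [G] and [v w] is the
    projection onto its range. *)
Lemma graph_operator_pair G : isometry_graph G -> graph_closed G -> G 0 ->
  exists v w : bounded_operator H, [/\ forall x, G (w (v x), v x),
    forall x, G (w x, v (w x)),
    forall x q, G q -> '[x - w (v x), q.1] = 0 &
    forall x q, G q -> '[x - v (w x), q.2] = 0].
Proof.
move=> gG cG G0.
have [lG isoG] := gG.
have [v vP] := graph_operator gG cG G0.
have [|||w wP] := @graph_operator [set p | G (p.2, p.1)].
- split=> [a p q Gp Gq|p q Gp Gq]; last by rewrite (isoG _ _ Gp Gq).
  exact: (lG a _ _ Gp Gq).
- move=> p pG; apply: cG => e /pG[q [Gq q1 q2]].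
  by exists (q.2, q.1); split.
- exact: G0.
have inj1 d y z : G (d, y) -> G (d, z) -> y = z.
  move=> Gy Gz; apply/eqP; rewrite -subr_eq0 -normr_eq0.
  by rewrite -(graph_norm gG (graphB gG Gy Gz)) /= subrr normr0.
have inj2 c d y : G (c, y) -> G (d, y) -> c = d.
  move=> Gc Gd; apply/eqP; rewrite -subr_eq0 -normr_eq0.
  by rewrite (graph_norm gG (graphB gG Gc Gd)) /= subrr normr0.
have Gwv x : G (w (v x), v x).
  have [y [Gy yP]] := wP (v x); have [d [Gd _]] := vP x.
  suff e : v x = y by rewrite -e in Gy.
  apply/eqP; rewrite -subr_eq0 -inner_eq0.
  by apply/eqP/(yP (v x - y, d - w (v x)))/(graphB gG Gd Gy).
have Gvw x : G (w x, v (w x)).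
  have [y [Gy yP]] := vP (w x); have [d [Gd _]] := wP x.
  suff e : w x = y by rewrite -e in Gy.
  apply/eqP; rewrite -subr_eq0 -inner_eq0.
  by apply/eqP/(yP (w x - y, d - v (w x)))/(graphB gG Gd Gy).
exists v, w; split=> // x q Gq.
- by have [d [Gd dP]] := vP x; rewrite -(inj2 _ _ _ Gd (Gwv x)) dP.
- have [d [Gd dP]] := wP x; rewrite -(inj1 _ _ _ Gd (Gvw x)).
  by apply: (dP (q.2, q.1)); rewrite /= -surjective_pairing.
Qed.

(** The domain is moved into its own orthogonal complement. *)
Definition shift_graph G :=
  isometry_graph G /\ forall p q, G p -> G q -> '[p.1, q.2] = 0.

Definition maximal_shift G :=
  shift_graph G /\ forall B, (G `<` B)%classic -> ~ shift_graph B.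

Lemma maximal_shift_ex : exists G, maximal_shift G.
Proof.
apply: (@Zorn_bigcup _ shift_graph) => F FP totF.
have pair p q : (\bigcup_(X in F) X)%classic p -> (\bigcup_(X in F) X)%classic q ->
    exists X, [/\ F X, X p & X q].
  move=> [X FX Xp] [Y FY Yq].
  have [XY|YX] := totF _ _ FX FY; [exists Y|exists X]; split=> //.
    exact: XY.
  exact: YX.
split; [split=> [a p q Gp Gq|p q Gp Gq]|move=> p q Gp Gq];
  have [X [FX Xp Xq]] := pair _ _ Gp Gq; have [[lX isoX] sX] := FP _ FX.
- by exists X => //; apply: lX.
- exact: isoX.
- exact: sX.
Qed.

(** Otherwise the graph spanned by [G] and [r] would contradict maximality. *)
Lemma maximal_shift_extend G r : maximal_shift G ->
    (forall q, G q ->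
       [/\ '[r.1, q.1] = '[r.2, q.2], '[r.1, q.2] = 0 & '[q.1, r.2] = 0]) ->
    '[r.1, r.1] = '[r.2, r.2] -> '[r.1, r.2] = 0 ->
  G r.
Proof.
move=> [[gG sG] maxG] rG r12 rr0; apply: contrapT => Gr.
have [lG isoG] := gG.
(* [G] may be empty at this stage, so the zero vector is adjoined. *)
pose G0 p := p = 0 \/ G p.
have lG0 a p q : G0 p -> G0 q -> G0 (a *: p + q).
  move=> [->|Gp] [->|Gq]; rewrite ?scaler0 ?add0r; [by left|by right| |].
    by right; apply: lG => //; apply: graph0 gG Gp.
  by right; apply: lG.
have isoG0 p q : G0 p -> G0 q -> '[p.1, q.1] = '[p.2, q.2].
  by move=> [->|Gp] [->|Gq]; rewrite ?linear0l ?linear0r//; apply: isoG.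
have sG0 p q : G0 p -> G0 q -> '[p.1, q.2] = 0.
  by move=> [->|Gp] [->|Gq]; rewrite ?linear0l ?linear0r//; apply: sG.
have rG0 q : G0 q ->
    [/\ '[r.1, q.1] = '[r.2, q.2], '[r.1, q.2] = 0 & '[q.1, r.2] = 0].
  by move=> [->|/rG//]; rewrite !linear0l !linear0r.
pose B := [set q | exists c p, G0 p /\ q = c *: r + p]%classic.
apply: (maxG B).
  split=> [p Gp|BG].
    by exists 0, p; rewrite scale0r add0r; split=> //; right.
  apply/Gr/BG; exists 1, 0; rewrite scale1r addr0; split=> //; by left.
split; first split.
- move=> a _ _ [c [p [Gp ->]]] [d [q [Gq ->]]].
  exists (a * c + d), (a *: p + q); split; first exact: lG0.
  by rewrite scalerDr scalerDl scalerA addrACA.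
- move=> _ _ [c [p [Gp ->]]] [d [q [Gq ->]]] /=.
  have [rp _ _] := rG0 _ Gp; have [rq _ _] := rG0 _ Gq.
  have pr : '[p.1, r.1] = '[p.2, r.2] by rewrite innerC rp -innerC.
  rewrite !linearDl/= !linearDr/= !linearZl_LR/= !linearZr_LR/=.
  by rewrite r12 rq pr (isoG0 _ _ Gp Gq).
- move=> _ _ [c [p [Gp ->]]] [d [q [Gq ->]]] /=.
  have [_ _ pr] := rG0 _ Gp; have [_ rq _] := rG0 _ Gq.
  rewrite !linearDl/= !linearDr/= !linearZl_LR/= !linearZr_LR/=.
  by rewrite rr0 rq pr (sG0 _ _ Gp Gq) !mulr0 !addr0.
Qed.

Lemma adherent_inner G p x y : adherent G p ->
    (forall q, G q -> '[q.1, x] + '[q.2, y] = 0) ->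
  '[p.1, x] + '[p.2, y] = 0.
Proof.
move=> pG Gxy; apply: (@small_eq0 _ (`|x| + `|y|)); first by rewrite addr_ge0.
move=> e /pG[q [Gq q1 q2]]; rewrite -[_ + _]subr0 -(Gxy q Gq) opprD addrACA.
rewrite -!linearBl/= mulrDr (le_trans (ler_normD _ _))//.
by rewrite lerD// (le_trans (cauchy_schwarz _ _))// ler_wpM2r.
Qed.

(** The constraints pass to the limit, first in one argument and then in the
    other, so that a limit point of [G] can be adjoined to [G]. *)
Lemma maximal_shift_closed G : maximal_shift G -> graph_closed G.
Proof.
move=> mG p pG; have [[[lG isoG] sG] _] := mG.
have lim := adherent_inner pG.
have iso q : G q -> '[p.1, q.1] = '[p.2, q.2].
  move=> Gq; apply/eqP; rewrite -subr_eq0 -linearNr; apply/eqP/lim => s Gs.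
  by rewrite linearNr/= (isoG _ _ Gs Gq) subrr.
have shl q : G q -> '[p.1, q.2] = 0.
  move=> Gq; have := lim q.2 0; rewrite linear0r addr0; apply=> s Gs.
  by rewrite linear0r addr0 sG.
have shr q : G q -> '[q.1, p.2] = 0.
  move=> Gq; apply: inner_eq0C; have := lim 0 q.1; rewrite linear0r add0r; apply=> s Gs.
  by rewrite linear0r add0r; apply: inner_eq0C; apply: sG.
apply: maximal_shift_extend => //.
- by move=> q Gq; rewrite iso// shl// shr.
- apply/eqP; rewrite -subr_eq0 -linearNr; apply/eqP/lim => s Gs.
  by rewrite linearNr/= innerC iso// -innerC subrr.
- have := lim p.2 0; rewrite linear0r addr0; apply=> s Gs.
  by rewrite linear0r addr0 shr.
Qed.

(** The operators attached to a maximal graph. The remainder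
    [1 - w v - v w] projects onto the orthogonal complement of the domain and
    the range; two orthogonal nonzero vectors in it, scaled to the same norm,
    would give a pair extending the graph, so its rank is at most one. *)
Lemma halving_operators : exists v w : bounded_operator H,
  [/\ v * w * v = v, w * v * w = w, v * v = 0, w * w = 0 &
      forall x y, (1 - w * v - v * w) x != 0 ->
        exists c, (1 - w * v - v * w) y = c *: (1 - w * v - v * w) x].
Proof.
have [G mG] := maximal_shift_ex; have [[gG sG] _] := mG; have [lG isoG] := gG.
have cG := maximal_shift_closed mG.
have G0 : G 0.
  by apply: maximal_shift_extend => [//|q _||]; rewrite !(linear0l, linear0r).
have [v [w [Gwv Gvw projD projR]]] := graph_operator_pair gG cG G0.
have norm0 d y : G (d, y) -> d = 0 -> y = 0.
  by move=> Gdy d0; apply/eqP; rewrite -normr_eq0 -(graph_norm gG Gdy) /= d0 normr0.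
have norm0' d y : G (d, y) -> y = 0 -> d = 0.
  by move=> Gdy y0; apply/eqP; rewrite -normr_eq0 (graph_norm gG Gdy) /= y0 normr0.
have act d y : G (d, y) -> [/\ v d = y, w y = d, v y = 0 & w d = 0].
  move=> Gdy; split.
  - have Gr := graphB gG Gdy (Gwv d).
    apply/esym/eqP; rewrite -subr_eq0; apply/eqP/(norm0 _ _ Gr).
    by apply/eqP; rewrite -inner_eq0; apply/eqP/(projD d _ Gr).
  - have Gr := graphB gG Gdy (Gvw y).
    apply/esym/eqP; rewrite -subr_eq0; apply/eqP/(norm0' _ _ Gr).
    by apply/eqP; rewrite -inner_eq0; apply/eqP/(projR y _ Gr).
  - apply: norm0 (Gwv y) _; apply/eqP; rewrite -inner_eq0.
    have := projD y _ (Gwv y); rewrite linearBl/= => /eqP.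
    by rewrite subr_eq0 => /eqP <-; apply/eqP/inner_eq0C/(sG _ _ (Gwv y) Gdy).
  - apply: norm0' (Gvw d) _; apply/eqP; rewrite -inner_eq0.
    have := projR d _ (Gvw d); rewrite linearBl/= => /eqP.
    by rewrite subr_eq0 => /eqP <-; apply/eqP/(sG _ _ Gdy (Gvw d)).
exists v, w; split; try (apply: bounded_operator_eq => x).
- by have [] := act _ _ (Gwv x).
- by have [] := act _ _ (Gvw x).
- by have [] := act _ _ (Gwv x).
- by have [] := act _ _ (Gvw x).
set e := 1 - w * v - v * w => x y ex0.
have eE z : e z = z - w (v z) - v (w z) by [].
have eD z q : G q -> '[e z, q.1] = 0.
  move=> Gq; rewrite eE linearBl/= (projD z _ Gq) sub0r.
  by rewrite (inner_eq0C (sG _ _ Gq (Gvw z))) oppr0.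
have eR z q : G q -> '[e z, q.2] = 0.
  move=> Gq; rewrite eE addrAC linearBl/= (projR z _ Gq) sub0r.
  by rewrite (sG _ _ (Gwv z) Gq) oppr0.
have ex_norm : `|e x| ^+ 2 != 0 by rewrite sqrf_eq0 normr_eq0.
exists ('[e y, e x] / `|e x| ^+ 2); apply/eqP; rewrite -subr_eq0.
apply: contraT; set k := _ / _; set z := _ - _ => z0.
have zx : '[z, e x] = 0.
  by rewrite linearBl/= linearZl_LR/= inner_norm mulfVK// subrr.
have zE : z = e (y - k *: x) by rewrite linearB linearZ.
have t0 : `|z| != 0 by rewrite normr_eq0.
pose t := `|e x| / `|z|.
have Gxz : G (e x, t *: z).
  apply: maximal_shift_extend => //=.
  - move=> q Gq; rewrite linearZl_LR linearZr_LR/= zE (eR _ _ Gq) (eD _ _ Gq).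
    by rewrite (eR _ _ Gq) (inner_eq0C (eD _ _ Gq)) !mulr0.
  - rewrite !inner_norm normrZ /t normrM normfV !normr_id mulfVK//.
  - by rewrite linearZr_LR/= (inner_eq0C zx) mulr0.
by have /eqP := eD x _ Gxz; rewrite /= inner_eq0 (negPf ex0).
Qed.

(** With the equivalent projections [e1 = w v] and [e2 = v w] and the rank one
    remainder [e3 = 1 - e1 - e2]: diagonal corners of [e1] factor through [e2]
    and conversely by means of [v] and [w], and those of [e3] factor through
    [e1] by rank one operators, [e1] being nonzero in dimension at least 2. *)
Lemma bounded_operator_idempotent_generated :
  dim_ge H 2 -> idempotent_generated (bounded_operator H).
Proof.
move=> [b b_free]; have [v [w [vwv wvw vv ww rank1_e3]]] := halving_operators.
pose e (i : 'I_3) : bounded_operator H :=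
  match val i with 0 => w * v | 1 => v * w | _ => 1 - w * v - v * w end.
have E1 : w * v * (w * v) = w * v by rewrite mulrA wvw.
have E2 : v * w * (v * w) = v * w by rewrite mulrA vwv.
have E12 : w * v * (v * w) = 0 by rewrite mulrA -[w * v * v]mulrA vv mulr0 mul0r.
have E21 : v * w * (w * v) = 0 by rewrite mulrA -[v * w * w]mulrA ww mulr0 mul0r.
apply: (@idempotent_generated_peirce _ 'I_3 e).
- by rewrite !big_ord_recl big_ord0 /e /= addr0 [v * w + _]addrC subrK addrC subrK.
- case=> [[|[|[|//]]] ?] [[|[|[|//]]] ?]; rewrite /e //= => _;
    by rewrite ?mulrBl ?mulrBr ?mul1r ?mulr1 ?E1 ?E2 ?E12 ?E21
         ?subrr ?subr0 ?sub0r ?subrr.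
have vwvA (z : bounded_operator H) : z * v * w * v = z * v.
  by rewrite -!mulrA (mulrA v) vwv.
have wvwA (z : bounded_operator H) : z * w * v * w = z * w.
  by rewrite -!mulrA (mulrA w) wvw.
case=> [[|[|[|//]]] ?].
- exists (lift ord0 ord0) => // x; exists (x * w), v; rewrite /e /=.
  by rewrite !mulrA !vwvA.
- exists ord0 => // x; exists (x * v), w; rewrite /e /=.
  by rewrite !mulrA !wvwA.
exists ord0 => // x; rewrite /e /=; set f := 1 - _ - _.
have f1 : f * (w * v) = 0 by rewrite /f !mulrBl mul1r E1 E21 subrr subr0.
have f2 : f * (v * w) = 0 by rewrite /f !mulrBl mul1r E2 E12 subr0 subrr.
have ff : f * f = f by rewrite {2}/f !mulrBr mulr1 f1 f2 !subr0.
have ffz z : f (f z) = f z by rewrite -{3}ff.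
have [f0|/existsNP[y /eqP fy]] := pselect (forall y, f y = 0).
  exists 0, 0; have -> : f = 0 by apply: bounded_operator_eq.
  by rewrite !mul0r.
(* If [w v] were zero, the remainder would be the identity, of rank one. *)
have [d d0 e1d] : exists2 d, d != 0 & (w * v) d = d.
  have [wv0|/existsNP[z /eqP wvz]] := pselect (forall z, (w * v) z = 0); last first.
    by exists ((w * v) z) => //; rewrite -{3}E1.
  have {}wv0 : w * v = 0 by apply: bounded_operator_eq.
  have w0 : w = 0 by rewrite -wvw wv0 mul0r.
  have fid z : f z = z by rewrite /f w0 mul0r mulr0 !subr0.
  have line z : exists c, z = c *: y.
    by have [c] := rank1_e3 y z fy; rewrite !fid; exists c.
  have [c b0] := line (b ord0); have [c' b1] := line (b (lift ord0 ord0)).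
  have sum0 : \sum_(i < 2) (if i == ord0 then c' else - c) *: b i = 0.
    rewrite !big_ord_recl big_ord0 /= b0 b1 !scalerA addr0 mulrC.
    by rewrite mulNr scaleNr subrr.
  have c0 : - c = 0 := b_free _ sum0 (lift ord0 ord0).
  have := free_neq0 b_free ord0.
  by rewrite b0 -[c]opprK c0 oppr0 scale0r eqxx.
have [k xfy] : exists k, f (x (f y)) = k *: f y by apply: rank1_e3.
(* The second factor sends [f y] to a multiple of [d], in the range of [w v],
   and [a] sends [d] back to the multiple of [f y] given by the eigenvalue [k]
   of [f x f]. *)
pose a := (k / ('[f y, f y] * '[d, d])) *: rank1 inner_norm (f y) d.
exists a, (rank1 inner_norm d (f y)); apply: bounded_operator_eq => z.
have [c fz] := rank1_e3 y z fy; rewrite -/f in fz.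
have lin (g : bounded_operator H) t u : g (t *: u) = t *: g u by apply: linearZ.
rewrite -[LHS]/(f (x (f z))) fz !lin xfy.
rewrite -[RHS]/(f (a ((w * v) (rank1 inner_norm d (f y) (f z))))).
rewrite fz rank1E !lin e1d.
rewrite ffz !scalerA !linearZl_LR/=; congr (_ *: _).
by field; rewrite !inner_eq0 fy d0.
Qed.

End Halving.

(** * Scalars and iterated commutators *)

Section ScalarPlusCentral.
Variables (K : numFieldType) (V : normedModType K).
Implicit Types (A B : bounded_operator V) (s : seq (bounded_operator V)).

Lemma foldl_lieZ s a A :
  foldl (@lie _) (a *: A) s = a *: foldl (@lie _) A s.
Proof.
elim: s A => [//|B s IHs] A /=; rewrite -IHs; congr foldl.
by rewrite /lie scalerBr bounded_operator_scalerAl bounded_operator_scalerAr.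
Qed.

Lemma lie_scalar_plus_central l m A B :
  lie (l *: A + m *: (1 : bounded_operator V)) B = l *: lie A B.
Proof.
rewrite /lie mulrDl mulrDr opprD addrACA -!bounded_operator_scalerAl mul1r.
rewrite -!bounded_operator_scalerAr mulr1 subrr addr0 scalerBr.
by [].
Qed.

End ScalarPlusCentral.

Theorem proposition5p3 (R : realType) (H : completeNormedModType R[i])
  (inner : {dot H for Num.conj})
  (inner_norm : forall x : H, inner x x = `|x| ^+ 2)
  (dimH : dim_ge H 2)
  (n : nat) (n_ge2 : (2 <= n)%N)
  (phi : {linear bounded_operator H -> bounded_operator H}) :
  [<-> lie_centralizer n phi;
       cond_N n phi;
       cond_Nl n phi;
       cond_Nr n phi;
       cond_T n phi;
       cond_Tl n phi;
       cond_Tr n phi;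
       exists (lambda : R[i]) (mu : {scalar bounded_operator H}),
         (forall A : bounded_operator H, phi A = lambda *: A + mu A *: (1 : bounded_operator H)) /\
         (forall s : n.-tuple (bounded_operator H), mu (lie_p s) = 0)].
Proof.
have genB := bounded_operator_idempotent_generated inner_norm dimH.
have [b b_free] := dimH.
have u0 := free_neq0 b_free ord0.
have Tl_i : cond_Tl n phi -> lie_centralizer n phi.
  exact: cond_Tl_lie_centralizer.
have Tr_i : cond_Tr n phi -> lie_centralizer n phi.
  exact: cond_Tr_lie_centralizer.
tfae.
- exact: lie_centralizer_N.
- by case.
- by move=> /cond_Nl_Tl/Tl_i/lie_centralizer_N[].
- by move=> /cond_Nr_Tr/Tr_i/lie_centralizer_T.
- by case.
- by move=> /Tl_i/lie_centralizer_T[].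
- move=> /Tr_i cphi.
  have [l [mu phiE]] := commuting_map_scalar inner_norm
    (lie_centralizer_commuting inner_norm cphi) u0.
  exists l, mu; split=> // -[s /= /eqP sn]; move: n_ge2 sn cphi.
  case: s => [|A [|B s]] /= n2 sn; [by rewrite -sn in n2|by rewrite -sn in n2|].
  move=> cphi; have /eqP s2 : size s = (n - 2)%N by rewrite -sn subn2.
  have := cphi A B (Tuple s2).
  rewrite /= phiE phiE lie_scalar_plus_central foldl_lieZ -[RHS]addr0 => /addrI.
  move=> /(congr1 (fun C : bounded_operator H => C (b ord0))).
  rewrite -[LHS]/(_ *: b ord0) => /eqP.
  by rewrite scaler_eq0 (negPf u0) orbF => /eqP.
- move=> [l [mu [phiE mu0]]] A B s.
  have sn : size [:: A, B & s] == n by rewrite /= size_tuple -(addn2 (n - 2)) subnK.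
  have /= := mu0 (Tuple sn).
  rewrite /= !phiE lie_scalar_plus_central foldl_lieZ => ->.
  by rewrite scale0r addr0.
Qed.
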